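(* Let $p>0$ and $s>0$ be real numbers. For every integer $k>s$ and every $x>0$, $$D^s(x^p)=D^kJ^{k-s}(x^p)=\frac{\Gamma(p+1)}{\Gamma(p-s+1)}\,x^{p-s};$$ in particular, the expression $D^kJ^{k-s}(x^p)$ defining $D^s(x^p)$ is independent of the choice of the integer $k>s$.
   Context: For a real number $r>0$, the $r$-order integral operator $J^r$ is defined by $$J^r(f)(x)=\frac{1}{\Gamma(r)}\int_0^x (x-y)^{r-1}f(y)\,dy,\qquad x>0,$$ where $\Gamma$ is Euler's gamma function. For a positive integer $k$, $D^k$ is the ordinary $k$-th derivative with respect to $x$. For a real number $s>0$, $D^s$ is defined by choosing an integer $k>s$ and setting $D^s(f)(x)=D^kJ^{k-s}(f)(x)$. $D^s(x^p)$ and $J^r(x^p)$ denote the values at $x$ of the operator applied to the function $f(x)=x^p$. Convention: $\Gamma$ is extended to negative non-integer arguments as usual, and $1/\Gamma(z)=0$ when $z$ is a non-positive integer. *)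

(* Defs.v *)
From mathcomp Require Export all_boot all_order all_algebra.
From mathcomp Require Export all_classical all_reals all_analysis.

Set Implicit Arguments.
Unset Strict Implicit.
Unset Printing Implicit Defensive.

Import Order.TTheory GRing.Theory Num.Theory.
Import numFieldNormedType.Exports.

Local Open Scope classical_set_scope.
Local Open Scope ring_scope.

Definition Gamma_integral {R : realType} (z : R) : R :=
  \int[lebesgue_measure]_(t in `]0, +oo[) (t `^ (z - 1) * expR (- t)).

(* [Num.truncn (1 - z)] is the least natural number n such that 0 < z + n
   (so n = 0 when 0 < z); the extension to z <= 0 is by the functional equation
   Gamma (z + n) = z (z + 1) ... (z + n - 1) Gamma z.  The value at a pole
   z = 0, -1, -2, ... is meaningless. *)
Definition Gamma {R : realType} (z : R) : R :=
  let n := Num.truncn (1 - z) in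
  Gamma_integral (z + n%:R) / \prod_(i < n) (z + i%:R).

(* 1 / Gamma, set to 0 at the poles of Gamma. *)
Definition invGamma {R : realType} (z : R) : R :=
  if - z \is a Num.nat then 0 else (Gamma z)^-1.

Definition fracJ {R : realType} (r : R) (f : R -> R) (x : R) : R :=
  (Gamma r)^-1 *
  \int[lebesgue_measure]_(y in `]0, x[) ((x - y) `^ (r - 1) * f y).

(* The integral defining [fracJ r f x] converges (absolutely). *)
Definition fracJ_exists {R : realType} (r : R) (f : R -> R) (x : R) : Prop :=
  (@lebesgue_measure R).-integrable `]0, x[
    (fun y : R => ((x - y) `^ (r - 1) * f y)%:E).

(* The successive derivatives of g up to order k all exist at x; [derive1n] is
   a total function with a default value where the limit does not exist. *)
Definition derivable1n {R : realType} (k : nat) (g : R -> R) (x : R) : Prop :=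
  forall j : nat, (j < k)%N -> derivable (derive1n j g) x 1.

Definition fracD_with {R : realType} (k : nat) (s : R) (f : R -> R) (x : R) : R :=
  derive1n k (fracJ (k%:R - s) f) x.

(* [get] makes the (unspecified) choice of an integer k > s. *)
Definition fracD {R : realType} (s : R) (f : R -> R) (x : R) : R :=
  fracD_with (get [set k : nat | s < k%:R]) s f x.

(* Main.v *)
Require Import Defs.
From mathcomp Require Import ring lra measurable_realfun.

Import Order.TTheory GRing.Theory Num.Theory.
Import numFieldNormedType.Exports.

Local Open Scope classical_set_scope.
Local Open Scope ring_scope.

(* Integrating (x-y)^(r-1) y^(q-1) exp(-x) over 0 < y < x in both orders gives
   Euler's identity Gamma(r) Gamma(q) = Gamma(q+r) B(r,q) in the extended reals.
   The case r = 1, with B(1,z) = 1/z, is the functional equation of Gamma, and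
   the latter yields finiteness.  By scaling,
   J^(k-s)(x^p) = Gamma(p+1) / Gamma(p+1+k-s) x^(p+k-s) for x > 0.  Its k-th
   derivative brings out the factor (p-s+1) ... (p-s+k), which is
   Gamma(p-s+1+k) / Gamma(p-s+1), and is 0 exactly at a pole of Gamma(p-s+1). *)

(** * Affine change of variables for integrals of nonnegative functions *)

Section affine_substitution.
Context {R : realType}.
Notation mu := (@lebesgue_measure R).
Variables (a b : R).
Hypothesis a_gt0 : 0 < a.

Let phi (t : measurableTypeR R) : measurableTypeR R := a * t + b.

Let measurable_phi : measurable_fun [set: measurableTypeR R] phi.
Proof. by apply: measurable_funD => //; exact: measurable_funM. Qed.

(** Lebesgue measure is determined by its values on the intervals []c, d]]; their preimages under
    [phi] have length $(d-c)/a$, and the scaling by [a] restores $d-c$. *)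
Let lebesgue_measure_affine (A : set R) : measurable A ->
  pushforward (mscale (NngNum (ltW a_gt0)) mu) phi A = mu A.
Proof.
move=> mA; apply/esym/lebesgue_measure_unique => //= _ [[c d]] _ <-.
rewrite /pushforward /mscale/=.
have -> : phi @^-1` `]c, d] = `](c - b) / a, (d - b) / a]%classic.
  by apply/seteqP; split=> t /=;
    rewrite !in_itv/= ltr_pdivrMr// ler_pdivlMr// ltrBlDr lerBrDr (mulrC t).
rewrite !lebesgue_measure_itv/= !lte_fin ltr_pM2r ?invr_gt0// ltrD2r.
case: ifPn => _; last by rewrite mule0.
by rewrite -!EFinD -EFinM; congr EFin; field; rewrite gt_eqF.
Qed.

Lemma ge0_integral_affine (D : set R) (f : R -> \bar R) :
  measurable D -> measurable_fun D f -> (forall x, D x -> 0 <= f x)%E ->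
  (\int[mu]_(x in D) f x =
   a%:E * \int[mu]_(t in [set t | D (a * t + b)%R]) f (a * t + b)%R)%E.
Proof.
move=> mD mf f0.
have mphiD : measurable (phi @^-1` D).
  by rewrite -[X in measurable X]setTI; exact: measurable_phi.
transitivity
    (\int[pushforward (mscale (NngNum (ltW a_gt0)) mu) phi]_(x in D) f x)%E.
  by apply: eq_measure_integral => A mA _; exact/esym/lebesgue_measure_affine.
rewrite ge0_integral_pushforward//; last by move=> x; rewrite inE; exact: f0.
rewrite ge0_integral_mscale//=; last by move=> x; exact: f0.
apply: (measurable_comp mD) => //; first by move=> _ [t Dt <-].
exact: measurable_funTS.
Qed.

End affine_substitution.

(** * Euler's Gamma and Beta integrals *)

Section euler_integrals.
Context {R : realType}.
Notation mu := (@lebesgue_measure R).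
Implicit Types r q x z : R.

(** Valued in the extended reals, so that Tonelli's theorem can be applied before finiteness is
    known. *)
Definition egamma z : \bar R :=
  (\int[mu]_(t in `]0%R, +oo[) (t `^ (z - 1) * expR (- t))%:E)%E.

Definition ebeta r q : \bar R :=
  (\int[mu]_(y in `]0%R, 1%R[) ((1 - y) `^ (r - 1) * y `^ (q - 1))%:E)%E.

Lemma egamma_ge0 z : (0 <= egamma z)%E.
Proof.
by apply: integral_ge0 => t _; rewrite lee_fin mulr_ge0 ?powR_ge0 ?expR_ge0.
Qed.

Lemma ebeta_ge0 r q : (0 <= ebeta r q)%E.
Proof.
by apply: integral_ge0 => t _; rewrite lee_fin mulr_ge0 ?powR_ge0.
Qed.

Lemma measurable_gamma_integrand z (D : set R) :
  measurable_fun D (fun t : R => (t `^ (z - 1) * expR (- t))%:E).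
Proof.
apply: measurable_funTS; apply/measurable_EFinP/measurable_funM.
  exact: measurable_powR.
by apply: measurableT_comp => //; exact: measurableT_comp.
Qed.

Lemma measurable_beta_integrand x r q (D : set R) :
  measurable_fun D (fun y : R => ((x - y) `^ (r - 1) * y `^ (q - 1))%:E).
Proof.
apply: measurable_funTS; apply/measurable_EFinP/measurable_funM; last first.
  exact: measurable_powR.
apply: (measurableT_comp (measurable_powR _)).
exact: measurable_funB.
Qed.

Lemma integral_beta_scale x r q : 0 < x ->
  (\int[mu]_(y in `]0%R, x[) ((x - y) `^ (r - 1) * y `^ (q - 1))%:E =
   (x `^ (q + r - 1))%:E * ebeta r q)%E.
Proof.
move=> x0.
rewrite (ge0_integral_affine _ 0 x0); last 3 first.
- exact: measurable_itv.
- exact: measurable_beta_integrand.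
- by move=> y _; rewrite lee_fin mulr_ge0 ?powR_ge0.
have -> : [set t | `]0, x[%classic (x * t + 0)] = `]0, 1[%classic :> set R.
  apply/seteqP; split=> t /=; rewrite !in_itv/= addr0.
    by rewrite pmulr_rgt0// gtr_pMr.
  by rewrite pmulr_rgt0// gtr_pMr.
(* In the substitution $y = xt$, one factor $x$ is the Jacobian and the two powers come out of $(x -
   xt)^{r-1}$ and $(xt)^{q-1}$. *)
have xq : x `^ (q + r - 1) = x * (x `^ (r - 1) * x `^ (q - 1)).
  rewrite -powRD; last by rewrite (gt_eqF x0) implybT.
  rewrite -[X in X * _]powRr1 ?ltW// -powRD; last by rewrite (gt_eqF x0) implybT.
  by congr powR; ring.
rewrite xq EFinM -muleA; congr (_ * _)%E.
rewrite /ebeta -ge0_integralZl//; last 3 first.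
- exact: measurable_beta_integrand.
- by move=> y _; rewrite lee_fin mulr_ge0 ?powR_ge0.
- by rewrite lee_fin mulr_ge0 ?powR_ge0.
apply: eq_integral => t; rewrite inE/= in_itv/= => /andP[t0 t1].
rewrite addr0 -EFinM; congr EFin.
rewrite (_ : x - x * t = x * (1 - t)); last by ring.
by rewrite !powRM ?subr_ge0 ?ltW//; ring.
Qed.

(* Tonelli on the region [0 < y < x]; both sides may be [+oo]. *)
Lemma egammaM r q : (egamma r * egamma q = egamma (q + r) * ebeta r q)%E.
Proof.
(* Here [w] stands for $(x, y)$, and [f] cuts [g] off outside the region, so that both iterated
   integrals run over the whole line. *)
pose g (w : R * R) := (w.1 - w.2) `^ (r - 1) * w.2 `^ (q - 1) * expR (- w.1).
pose f (w : R * R) : \bar R :=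
  (if (0 < w.2) && (w.2 < w.1) then g w else 0)%:E.
have g0 w : 0 <= g w by rewrite !mulr_ge0 ?powR_ge0 ?expR_ge0.
have f0 w : (0 <= f w)%E by rewrite lee_fin; case: ifP.
have mg : measurable_fun [set: R * R] g.
  apply: measurable_funM; last first.
    by apply: measurableT_comp => //; exact: measurableT_comp.
  apply: measurable_funM.
    apply: (measurableT_comp (measurable_powR _)).
    exact: measurable_funB.
  exact: (measurableT_comp (measurable_powR _)).
have mf : measurable_fun [set: R * R] f.
  apply/measurable_EFinP; apply: measurable_fun_ifT => //.
  by apply: measurable_and; exact: measurable_fun_ltr.
have := fubini_tonelli (m1 := mu) (m2 := mu) _ mf f0.
(* Integrating in $y$ first: the scaled Beta integral leaves $x^{q+r-1} e^{-x}$ times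
   [ebeta r q]. *)
rewrite (_ : (\int[mu]_x _)%E = egamma (q + r) * ebeta r q)%E; last first.
  transitivity (\int[mu]_(x in `]0%R, +oo[)
      ((x `^ (q + r - 1) * expR (- x))%:E * ebeta r q))%E; last first.
    rewrite ge0_integralZr ?ebeta_ge0//; first exact: measurable_gamma_integrand.
    by move=> y _; rewrite lee_fin mulr_ge0 ?powR_ge0 ?expR_ge0.
  rewrite [RHS]integral_mkcond; apply: eq_integral => x _.
  rewrite patchE mem_setE in_itv/= andbT; case: ifPn.
    move=> x0.
    rewrite EFinM muleAC -integral_beta_scale// -ge0_integralZr//; last 2 first.
    - exact: measurable_beta_integrand.
    - by move=> y _; rewrite lee_fin mulr_ge0 ?powR_ge0.
    rewrite [RHS]integral_mkcond; apply: eq_integral => y _.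
    rewrite patchE mem_setE in_itv/= /f/=.
    by case: ifP => // _; rewrite -EFinM.
  rewrite -leNgt => x0.
  rewrite integral0_eq// => y _; rewrite /f/=.
  by case: ifP => // /andP[y0 yx]; move: (lt_trans y0 yx); rewrite ltNge x0.
(* Integrating in $x$ first: the shift $x = t + y$ splits $e^{-x}$ into $e^{-t} e^{-y}$ and
   separates the variables. *)
rewrite (_ : (\int[mu]_x _)%E = egamma r * egamma q)%E//.
transitivity (\int[mu]_(y in `]0%R, +oo[)
    (egamma r * (y `^ (q - 1) * expR (- y))%:E))%E; last first.
  rewrite ge0_integralZl ?egamma_ge0//; first exact: measurable_gamma_integrand.
  by move=> y _; rewrite lee_fin mulr_ge0 ?powR_ge0 ?expR_ge0.
rewrite [RHS]integral_mkcond; apply: eq_integral => y _.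
rewrite patchE mem_setE in_itv/= andbT; case: ifPn.
  move=> y0.
  transitivity (\int[mu]_(x in `]y, +oo[) (g (x, y))%:E)%E.
    rewrite [RHS]integral_mkcond; apply: eq_integral => x _.
    by rewrite patchE mem_setE in_itv/= /f/= y0/= andbT; case: ifP.
  rewrite (ge0_integral_affine _ y (@ltr01 R))//; last 2 first.
  - apply: measurable_funTS; apply/measurable_EFinP.
    exact: (measurableT_comp mg).
  - by move=> x _; rewrite lee_fin.
  rewrite mul1e /egamma -ge0_integralZr//; last 3 first.
  - exact: measurable_gamma_integrand.
  - by move=> t _; rewrite lee_fin mulr_ge0 ?powR_ge0 ?expR_ge0.
  - by rewrite lee_fin mulr_ge0 ?powR_ge0 ?expR_ge0.
  have -> : [set t | `]y, +oo[%classic (1 * t + y)] = `]0, +oo[%classic :> set R.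
    by apply/seteqP; split=> t /=; rewrite !in_itv/= !andbT mul1r ltrDr.
  apply: eq_integral => t _; rewrite /g/= mul1r addrK -EFinM; congr EFin.
  by rewrite opprD expRD; ring.
rewrite -leNgt => y0.
by rewrite integral0_eq// => x _; rewrite /f/= ltNge y0.
Qed.

End euler_integrals.

(** * Functional equation, finiteness and positivity of Gamma, and its reciprocal *)

Section gamma_function.
Context {R : realType}.
Notation mu := (@lebesgue_measure R).
Implicit Types r q x z : R.

(** The integrand is the exponential density of rate 1, of total mass 1; adding the endpoint 0
    matches its support. *)
Lemma egamma1 : egamma (1 : R) = 1%E.
Proof.
rewrite /egamma integral_itv_obnd_cbnd; last exact: measurable_gamma_integrand.
rewrite -(integral_exponential_pdf (@ltr01 R)) integral_mkcond.
apply: eq_integral => t _; rewrite /exponential_pdf !patchE.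
by case: ifP => //; rewrite subrr powRr0 !mul1r mulN1r.
Qed.

(** Fundamental theorem of calculus with antiderivative $t^z / z$, away from 0, where the integrand
    blows up if $z < 1$. *)
Lemma integral_powR_itvcc x z : 0 < x < 1 -> 0 < z ->
  (\int[mu]_(t in `[x, 1%R]) (t `^ (z - 1))%:E = ((1 - x `^ z) / z)%:E)%E.
Proof.
move=> /andP[x0 x1] z0.
have dF (t : R) : 0 < t ->
    is_derive t 1 (fun u : R => z^-1 * u `^ z) (t `^ (z - 1)).
  move=> t0; have := is_deriveZ z^-1 (is_derive1_powR z t0).
  by rewrite scalerA mulVf ?gt_eqF// scale1r.
have cF (y t : R) : 0 < t -> {for t, continuous (fun u : R => u `^ y)}.
  move=> t0; apply: differentiable_continuous; apply/derivable1_diffP.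
  by have [] := is_derive1_powR y t0.
have cF' (t : R) : 0 < t -> {for t, continuous (fun u : R => z^-1 * u `^ z)}.
  move=> t0; apply: differentiable_continuous; apply/derivable1_diffP.
  by have [] := dF _ t0.
rewrite (@continuous_FTC2 _ _ (fun t => z^-1 * t `^ z))//.
- by rewrite -EFinB powR1; congr EFin; field; rewrite gt_eqF.
- apply: continuous_in_subspaceT => t; rewrite inE/= in_itv/= => /andP[xt _].
  by apply: cF; exact: lt_le_trans xt.
- split.
  + move=> t; rewrite in_itv/= => /andP[xt _].
    by have [] := dF _ (lt_trans x0 xt).
  + by apply/cvg_at_right_filter; exact: cF'.
  + by apply/cvg_at_left_filter; exact: cF'.
- move=> t; rewrite in_itv/= => /andP[xt _].
  by rewrite derive1E; have [_ ->] := dF _ (lt_trans x0 xt).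
Qed.

(** Monotone convergence along the intervals $[1/(n+1), 1]$, which exhaust $]0, 1]$. *)
Lemma ebeta1 z : 0 < z -> ebeta 1 z = (z^-1)%:E.
Proof.
move=> z0.
have mpow (D : set R) : measurable_fun D (fun t : R => (t `^ (z - 1))%:E).
  by apply: measurable_funTS; apply/measurable_EFinP; exact: measurable_powR.
transitivity (\int[mu]_(t in `]0%R, 1%R[) (t `^ (z - 1))%:E)%E.
  by apply: eq_integral => t _; rewrite subrr powRr0 mul1r.
rewrite integral_itv_bndo_bndc// itv_open_bnd_bigcup.
pose F n := `[(0 + n.+1%:R^-1 : R), 1]%classic.
have cvgF : (\int[mu]_(t in F n) (t `^ (z - 1))%:E @[n --> \oo] -->
    \int[mu]_(t in \bigcup_n F n) (t `^ (z - 1))%:E)%E.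
  apply: ge0_nondecreasing_set_cvg_integral => //.
  - move=> m n mn; apply/subsetPset => t; rewrite /F/= !in_itv/= !add0r.
    move=> /andP[mt ->]; rewrite andbT; apply: le_trans mt.
    by rewrite lef_pV2 ?posrE ?ltr0n// ler_nat ltnS.
  - by move=> n; exact: measurable_itv.
  - by move=> n; exact: mpow.
  - by move=> n t _; rewrite lee_fin powR_ge0.
have cvgz : (((1 - (harmonic n : R) `^ z) / z)%:E @[n --> \oo] --> (z^-1)%:E)%E.
  apply/fine_cvgP; split => /=; first exact: nearW.
  rewrite -[X in _ --> X]mul1r -[X in X * _]subr0.
  apply: cvgMl; apply: cvgB; first exact: cvg_cst.
  have /cvg_at_rightP/(_ (@harmonic R)) := powR_cvg0 z0.
  apply; split; last exact: cvg_harmonic.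
  by move=> n; rewrite harmonic_gt0.
apply: (cvg_unique _ cvgF) => //.
(* The closed form is applied for $n > 0$: at $n = 0$ the interval shrinks to the point 1. *)
apply: cvg_trans cvgz; apply: near_eq_cvg; near=> n.
rewrite integral_powR_itvcc ?add0r// invr_gt0 ltr0n/= invf_lt1// ltr1n ltnS.
by near: n; exact: nbhs_infty_gt.
Unshelve. all: by end_near. Qed.

Lemma egammaS z : 0 < z -> egamma (z + 1) = (z%:E * egamma z)%E.
Proof.
move=> z0; have := egammaM 1 z; rewrite egamma1 mul1e ebeta1// => ->.
by rewrite muleCA -EFinM divff ?gt_eqF// mule1.
Qed.

(* The functional equation reduces to an argument [z + 1], where [t `^ z] is at
   most [1 + t ^+ n] as soon as [z <= n]. *)
Lemma egamma_lty z : 0 < z -> (egamma z < +oo)%E.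
Proof.
have egamma_nat n : egamma (n.+1%:R : R) \is a fin_num.
  elim: n => [|n ih]; first by rewrite egamma1.
  by rewrite -natr1 egammaS ?ltr0n// fin_numM.
move=> z0.
have [n zn] : exists n : nat, z < n%:R.
  by exists (Num.truncn z).+1; exact: truncnS_gt.
have : (egamma (z + 1) < +oo)%E.
  apply: (@le_lt_trans _ _ (egamma (1 : R) + egamma (n.+1%:R : R))%E); last first.
    apply: lte_add_pinfty; first by rewrite egamma1 ltry.
    by rewrite ltey_eq egamma_nat.
  rewrite /egamma -ge0_integralD//; last 4 first.
  - by move=> t _; rewrite lee_fin mulr_ge0 ?powR_ge0 ?expR_ge0.
  - exact: measurable_gamma_integrand.
  - by move=> t _; rewrite lee_fin mulr_ge0 ?powR_ge0 ?expR_ge0.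
  - exact: measurable_gamma_integrand.
  apply: ge0_le_integral => //.
  - by move=> t _; rewrite lee_fin mulr_ge0 ?powR_ge0 ?expR_ge0.
  - exact: measurable_gamma_integrand.
  - by apply: emeasurable_funD; exact: measurable_gamma_integrand.
  move=> t /=; rewrite in_itv/= andbT => t0.
  rewrite -EFinD lee_fin -mulrDl ler_wpM2r ?expR_ge0//.
  rewrite subrr powRr0 addrK -natr1 addrK.
  have [t1|t1] := leP t 1.
    apply: (@le_trans _ _ 1); last by rewrite lerDl powR_ge0.
    have := @ge0_ler_powR R z (ltW z0) t 1.
    by rewrite powR1; apply => //; rewrite nnegrE ltW.
  apply: (@le_trans _ _ (t `^ n%:R)); last by rewrite lerDr.
  by rewrite ler_powR// ltW.
(* Since $z > 0$, an infinite [egamma z] would make the product [z * egamma z] infinite too. *)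
by rewrite egammaS//; case: (egamma z) => [r _| |]; rewrite ?ltry ?gt0_muley ?lte_fin.
Qed.

Lemma egamma_fin_num z : 0 < z -> egamma z \is a fin_num.
Proof. by move=> z0; rewrite ge0_fin_numE ?egamma_ge0// egamma_lty. Qed.

(** Passing to $z + 1$ makes the exponent of $t$ positive, so the integrand is at least $e^{-2}$ on
    $[1, 2]$. *)
Lemma egamma_gt0 z : 0 < z -> (0 < egamma z)%E.
Proof.
move=> z0; suff : (0 < egamma (z + 1))%E.
  by rewrite egammaS// pmule_rgt0// lte_fin.
apply: (@lt_le_trans _ _ (expR (- 2))%:E); first by rewrite lte_fin expR_gt0.
have -> : (expR (- 2) : R)%:E =
    (\int[mu]_(t in `[1%R, 2%R]) (cst (expR (- 2))%:E) t)%E.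
  rewrite integral_cst//= lebesgue_measure_itv/= lte_fin ltr1n -EFinB.
  by rewrite -EFinM; congr EFin; ring.
apply: (@le_trans _ _ (\int[mu]_(t in `[1%R, 2%R])
    (t `^ (z + 1 - 1) * expR (- t))%:E)%E).
  apply: ge0_le_integral => //.
  - by move=> t _; rewrite lee_fin expR_ge0.
  - exact: measurable_gamma_integrand.
  move=> t /=; rewrite in_itv/= => /andP[t1 t2].
  rewrite lee_fin addrK -[leLHS]mul1r ler_pM ?expR_ge0//; last first.
    by rewrite ler_expR lerN2.
  by rewrite -[leLHS](powRr0 t) ler_powR// ltW.
apply: ge0_subset_integral => //.
- exact: measurable_gamma_integrand.
- by move=> t _; rewrite lee_fin mulr_ge0 ?powR_ge0 ?expR_ge0.
- move=> t /=; rewrite !in_itv/= andbT => /andP[t1 _].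
  by rewrite (lt_le_trans ltr01).
Qed.

Lemma EFin_Gamma_integral z : 0 < z -> (Gamma_integral z)%:E = egamma z.
Proof. by move=> z0; rewrite fineK// egamma_fin_num. Qed.

Lemma Gamma_integral_gt0 z : 0 < z -> 0 < Gamma_integral z.
Proof. by move=> z0; rewrite -lte_fin EFin_Gamma_integral// egamma_gt0. Qed.

Lemma Gamma_integralD z n : 0 < z ->
  Gamma_integral (z + n%:R) = \prod_(i < n) (z + i%:R) * Gamma_integral z.
Proof.
move=> z0; elim: n => [|n ih]; first by rewrite big_ord0 mul1r addr0.
have zn : 0 < z + n%:R by rewrite ltr_pwDl.
rewrite big_ord_recr/= mulrAC -ih -natr1 addrA; apply: EFin_inj.
rewrite EFinM (EFin_Gamma_integral _ zn).
rewrite EFin_Gamma_integral; last exact: addr_gt0.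
by rewrite (egammaS _ zn) muleC.
Qed.

Lemma GammaE z : 0 < z -> Gamma z = Gamma_integral z.
Proof.
move=> z0; rewrite /Gamma.
have -> : Num.truncn (1 - z) = 0%N.
  by apply/truncn0Pn; rewrite -ltNge ltrBlDr ltrDl.
by rewrite big_ord0 divr1 addr0.
Qed.

Lemma ebetaE r q : 0 < r -> 0 < q ->
  ebeta r q = (Gamma_integral r * Gamma_integral q / Gamma_integral (q + r))%:E.
Proof.
move=> r0 q0; have qr0 : 0 < q + r by rewrite addr_gt0.
have := egammaM r q; rewrite -!EFin_Gamma_integral// => /esym GB.
have Gqr := Gamma_integral_gt0 _ qr0.
by rewrite mulrC EFinM EFinM -GB muleA -EFinM mulVf ?gt_eqF// mul1e.
Qed.

(** Replaces the least shift built into [Gamma] by an arbitrary shift [n] into the positive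
    half-line, and covers the poles by the same formula. *)
Lemma invGamma_prod z n : 0 < z + n%:R ->
  invGamma z = \prod_(i < n) (z + i%:R) / Gamma_integral (z + n%:R).
Proof.
move=> zn; rewrite /invGamma; case: ifPn => [/natrP[m zm]|zN].
  (* At a pole $z = -m$ the factor of index $m < n$ vanishes. *)
  have mn : (m < n)%N by rewrite -(ltr_nat R) -zm -subr_gt0 opprK addrC.
  by rewrite (bigD1 (Ordinal mn))//= -zm subrr !mul0r.
rewrite /Gamma; set k := Num.truncn (1 - z).
have k1 : 1 - z < k.+1%:R by exact: truncnS_gt.
have zk : 0 < z + k%:R by move: k1; rewrite -natr1; lra.
have kn : (k <= n)%N.
  by rewrite truncn_le_nat -natr1; lra.
(* The factors of index [k] to [n - 1] carry [Gamma_integral (z + k%:R)] to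
   [Gamma_integral (z + n%:R)]. *)
rewrite invf_div -(subnKC kn) natrD addrA (Gamma_integralD (z + k%:R))//.
have -> : \prod_(i < k + (n - k)) (z + i%:R) =
    \prod_(i < k) (z + i%:R) * \prod_(i < n - k) (z + k%:R + i%:R).
  rewrite big_split_ord/=; congr (_ * _).
  by apply: eq_bigr => i _; rewrite natrD addrA.
have P_gt0 : 0 < \prod_(i < n - k) (z + k%:R + i%:R).
  by apply: prodr_gt0 => i _; rewrite ltr_pwDl.
by field; rewrite !gt_eqF ?Gamma_integral_gt0.
Qed.

End gamma_function.

(** * Fractional integrals and derivatives of powers *)

Section fractional_powers.
Context {R : realType}.
Notation mu := (@lebesgue_measure R).
Implicit Types a c p r s x : R.

(** The scaled Beta integral at $q = p + 1$; its finite value gives both the convergence and the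
    formula for [fracJ]. *)
Lemma integral_fracJ_powR r p x : 0 < r -> 0 < p -> 0 < x ->
  (\int[mu]_(y in `]0%R, x[) ((x - y) `^ (r - 1) * y `^ p)%:E =
   (x `^ (p + r) * (Gamma_integral r * Gamma_integral (p + 1) /
                    Gamma_integral (p + 1 + r)))%:E)%E.
Proof.
move=> r0 p0 x0; have q0 : 0 < p + 1 by rewrite addr_gt0.
have := integral_beta_scale x r (p + 1) x0.
by rewrite ebetaE// -EFinM addrK (_ : p + 1 + r - 1 = p + r)//; ring.
Qed.

Lemma fracJ_powR_exists r p x : 0 < r -> 0 < p -> 0 < x ->
  fracJ_exists r (fun y : R => y `^ p) x.
Proof.
move=> r0 p0 x0; apply/integrableP; split=> /=.
  by have := measurable_beta_integrand x r (p + 1) `]0, x[; rewrite addrK.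
under eq_integral do rewrite ger0_norm ?mulr_ge0 ?powR_ge0//.
by rewrite integral_fracJ_powR// ltry.
Qed.

Lemma fracJ_powR r p x : 0 < r -> 0 < p -> 0 < x ->
  fracJ r (fun y : R => y `^ p) x =
  Gamma_integral (p + 1) / Gamma_integral (p + 1 + r) * x `^ (p + r).
Proof.
move=> r0 p0 x0; rewrite /fracJ GammaE// /Rintegral integral_fracJ_powR//=.
have Gr := Gamma_integral_gt0 _ r0.
by rewrite mulrCA -(mulrA (Gamma_integral r)) mulKf ?gt_eqF// mulrC.
Qed.

(** Differentiation is local and the half-line $y > 0$ is a neighbourhood of $x$; this lets [g] be
    [fracJ] or one of its derivatives. *)
Lemma is_derive_powR_pos (g : R -> R) c a x :
  (forall y : R, 0 < y -> g y = c * y `^ a) -> 0 < x ->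
  is_derive x 1 g (c * a * x `^ (a - 1)).
Proof.
move=> gE x0; apply: (@near_eq_is_derive _ _ _ (fun y : R => c * y `^ a)).
  by near=> y; rewrite gE//; near: y; exact: lt_nbhsr.
have := is_deriveZ c (is_derive1_powR a x0).
by rewrite -mulrA.
Unshelve. all: by end_near. Qed.

Lemma derive1n_powR_pos (g : R -> R) c a n :
  (forall y : R, 0 < y -> g y = c * y `^ a) -> forall x, 0 < x ->
  derive1n n g x = c * \prod_(i < n) (a - i%:R) * x `^ (a - n%:R).
Proof.
move=> gE; elim: n => [|n ih] x x0.
  by rewrite big_ord0 mulr1 subr0 derive1n0 gE.
rewrite derive1nS derive1E.
have [_ ->] := is_derive_powR_pos (derive1n n g) _ _ x ih x0.
by rewrite big_ord_recr/= mulrA -natr1 opprD addrA.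
Qed.

Lemma derivable1n_powR_pos (g : R -> R) c a n x :
  (forall y : R, 0 < y -> g y = c * y `^ a) -> 0 < x -> derivable1n n g x.
Proof.
move=> gE x0 j _.
by have [] := is_derive_powR_pos _ _ _ x (derive1n_powR_pos g c a j gE) x0.
Qed.

(** The right-hand side is free of [k], whence the independence of the chosen integer. *)
Lemma derive1n_fracJ_powR p s (k : nat) x :
  0 < p -> s < k%:R -> 0 < x ->
  derive1n k (fracJ (k%:R - s) (fun y : R => y `^ p)) x =
  Gamma (p + 1) * invGamma (p - s + 1) * x `^ (p - s).
Proof.
move=> p0 sk x0; have r0 : 0 < k%:R - s by rewrite subr_gt0.
rewrite (derive1n_powR_pos _ _ _ k (fun y => fracJ_powR _ _ y r0 p0))//.
have zk : 0 < p - s + 1 + k%:R by lra.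
rewrite GammaE ?addr_gt0// (invGamma_prod _ k zk).
have -> : p + (k%:R - s) - k%:R = p - s by ring.
have -> : p + 1 + (k%:R - s) = p - s + 1 + k%:R by ring.
congr (_ * _); rewrite -mulrA; congr (_ * _); rewrite mulrC; congr (_ * _).
(* Reversing the index, $i \mapsto k - 1 - i$, turns $p + k - s - i$ into $p - s + 1 + i$. *)
rewrite (reindex_inj rev_ord_inj)/=; apply: eq_bigr => i _.
by rewrite natrB// -natr1; ring.
Qed.

End fractional_powers.

Theorem theorem7 (R : realType) (p s : R) (hp : 0 < p) (hs : 0 < s) :
  (forall k : nat, s < k%:R -> forall x : R, 0 < x ->
     [/\ fracJ_exists (k%:R - s) (fun y : R => y `^ p) x,
         derivable1n k (fracJ (k%:R - s) (fun y : R => y `^ p)) x,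
         fracD s (fun y : R => y `^ p) x
           = derive1n k (fracJ (k%:R - s) (fun y : R => y `^ p)) x
       & derive1n k (fracJ (k%:R - s) (fun y : R => y `^ p)) x
           = Gamma (p + 1) * invGamma (p - s + 1) * x `^ (p - s)])
  /\
  (forall k l : nat, s < k%:R -> s < l%:R -> forall x : R, 0 < x ->
     derive1n k (fracJ (k%:R - s) (fun y : R => y `^ p)) x
       = derive1n l (fracJ (l%:R - s) (fun y : R => y `^ p)) x).
Proof.
split=> [k sk x x0|k l sk sl x x0]; last by rewrite !derive1n_fracJ_powR.
have r0 : 0 < k%:R - s by rewrite subr_gt0.
split.
- exact: fracJ_powR_exists.
- exact: (derivable1n_powR_pos _ _ _ k x (fun y => fracJ_powR _ _ y r0 hp)).
(* The given [k] shows that the set is inhabited, so the integer picked by [get] belongs to it. *)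
- have sget : s < (get [set k : nat | s < k%:R])%:R.
    exact: (@getI _ [set k : nat | s < k%:R] _ sk).
  by rewrite /fracD /fracD_with !derive1n_fracJ_powR.
- exact: derive1n_fracJ_powR.
Qed.
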